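(* Let $N,n,d\ge1$ be integers, let $0<\mu\le L$, $\sigma,B,D>0$ and $\lambda_1,\dots,\lambda_N>0$. Put $\chi=\mu/L$, $y^0_*=L\mu nND^2/\sigma^2$, $T=\max\left(-\frac{\ln(y^0_* )}{\ln(1-\chi/2)},1\right)$, $\rho=\frac{n}{T\sigma^2}$, $$\kappa=\frac{16\sqrt{2e\,\ln(1.25\,Tn^2)\,\ln(4n^2)\,T}\;B}{n},\qquad \psi_i=\frac{\lambda_i}{L\mu d\kappa^2\rho^2}\quad(i=1,\dots,N).$$ Then the system $$\forall i\in\{1,\dots,N\}:\qquad \psi_i\left(1-\frac{\rho}{\Gamma}\right)\ \ge\ \frac{\beta_i}{\rho-\beta_i},\qquad \Gamma=\sum_{k=1}^N\beta_k,$$ in the unknowns $\beta_1,\dots,\beta_N\in[0,\rho)$ with $\Gamma>0$ has a solution if and only if there exists a real number $x\ge0$ such that $$\sum_{i=1}^N\frac{\psi_i x}{(\psi_i+1)x+1}\ \ge\ x+1 .$$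
   Context: Setting (differentially private strongly convex stochastic optimization). $N$ clients, each with $n$ data points, jointly minimize an $L$-smooth and $\mu$-strongly convex objective in dimension $d$ over a closed convex set of diameter at most $D$, using stochastic gradients with variance at most $\sigma^2$ and deviation from the true gradient at most $B/2$; client $i$ adds $N(0,\alpha_i^2 I)$ noise to each batch gradient. There are $T$ communication rounds with batch size $b=n/T$ (integrality of $T$ and $b$ is ignored). Write $\beta_i=\frac{1}{1/\rho+d\alpha_i^2}$. The accuracy loss is given by $\mathrm{Err}_i^2=\frac{1}{L\mu\Gamma}$, the privacy loss by $\mathrm{Leak}_i=\kappa/\alpha_i$, and the utility of client $i$ is $u_i=-\mathrm{Leak}_i^2-\lambda_i\mathrm{Err}_i^2=-\frac{\kappa^2}{\alpha_i^2}-\frac{\lambda_i}{L\mu\Gamma}$. The utility of local training is $u_i^0=-\frac{\lambda_i}{L\mu\rho}$. A protocol is mutually beneficial if $u_i\ge u_i^0$ for every $i$, which is equivalent to the system in the statement. *)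

(* Defs.v *)
From HB Require Import structures.
From mathcomp Require Import all_boot all_order all_algebra.
From mathcomp Require Import all_classical all_reals all_analysis.

Set Implicit Arguments.
Unset Strict Implicit.
Unset Printing Implicit Defensive.

Import Order.TTheory GRing.Theory Num.Theory.

Local Open Scope ring_scope.

Definition chi (R : realType) (mu L : R) : R := mu / L.

Definition y0star (R : realType) (N n : nat) (mu L sigma D : R) : R :=
  L * mu * n%:R * N%:R * D ^+ 2 / sigma ^+ 2.

(* The number of communication rounds T; its integrality is ignored. *)
Definition rounds (R : realType) (N n : nat) (mu L sigma D : R) : R :=
  Num.max (- (ln (y0star N n mu L sigma D) / ln (1 - chi mu L / 2))) 1.

Definition rho (R : realType) (N n : nat) (mu L sigma D : R) : R :=
  n%:R / (rounds N n mu L sigma D * sigma ^+ 2).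

Definition kappa (R : realType) (N n : nat) (mu L sigma B D : R) : R :=
  let T := rounds N n mu L sigma D in
  16 * Num.sqrt (2 * expR 1 * ln (5 / 4 * T * n%:R ^+ 2)
                 * ln (4 * n%:R ^+ 2) * T) * B / n%:R.

Definition psi (R : realType) (N n d : nat) (mu L sigma B D : R)
    (lambda : 'I_N -> R) (i : 'I_N) : R :=
  lambda i / (L * mu * d%:R * kappa N n mu L sigma B D ^+ 2
              * rho N n mu L sigma D ^+ 2).

(* [beta i] stands for 1 / (1 / r + d * alpha_i ^+ 2), where alpha_i is the
   noise level of client i; the admissible value 0 is the limit alpha_i = +oo,
   and the excluded value r is alpha_i = 0. *)
Definition benefit_system (R : realType) (N : nat) (r : R)
    (psi beta : 'I_N -> R) : Prop :=
  let Gamma := \sum_(k < N) beta k in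
  [/\ forall i, 0 <= beta i < r,
      0 < Gamma
    & forall i, psi i * (1 - r / Gamma) >= beta i / (r - beta i)].

(* Main.v *)
(** Put x + 1 = Gamma / rho. Solving the i-th inequality for beta_i turns it into
    beta_i / rho <= psi_i x / ((psi_i + 1) x + 1), and summing over i gives the
    condition on x. Conversely, given x, take equality in these bounds: then
    Gamma / rho >= x + 1, and enlarging Gamma only relaxes the system. *)

Require Import Defs.
From HB Require Import structures.
From mathcomp Require Import all_boot all_order all_algebra.
From mathcomp Require Import all_classical all_reals all_analysis.
From mathcomp Require Import ring lra.

Set Implicit Arguments.
Unset Strict Implicit.
Unset Printing Implicit Defensive.

Import Order.TTheory GRing.Theory Num.Theory.

Local Open Scope ring_scope.

Lemma rho_gt0 (R : realType) (N n : nat) (mu L sigma D : R) :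
  (0 < n)%N -> 0 < sigma -> 0 < rho N n mu L sigma D.
Proof.
move=> n0 s0; have T0 : 0 < rounds N n mu L sigma D.
  by rewrite /rounds lt_max ltr01 orbT.
by rewrite divr_gt0 ?ltr0n// mulr_gt0// exprn_gt0.
Qed.

(** [kappa] and [rho] enter only through their squares, so the signs of the logarithms inside
    [kappa] need no discussion. *)
Lemma psi_ge0 (R : realType) (N n d : nat) (mu L sigma B D : R)
    (lambda : 'I_N -> R) (i : 'I_N) :
  0 <= mu -> 0 <= L -> 0 <= lambda i -> 0 <= psi n d mu L sigma B D lambda i.
Proof.
move=> m0 L0 l0; rewrite /psi divr_ge0//.
by do 2! [apply: mulr_ge0; last exact: sqr_ge0]; rewrite !mulr_ge0.
Qed.

Section benefit_system.
Variables (R : realType) (N : nat) (r : R) (p : 'I_N -> R).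
Hypotheses (r0 : 0 < r) (p0 : forall i, 0 <= p i).

(** If Gamma were below [r], each left-hand side would be nonpositive, forcing every [beta i <= 0]
    and hence Gamma [<= 0]. This makes Gamma / [r] - 1 an admissible [x]. *)
Lemma benefit_system_sum_ge (beta : 'I_N -> R) :
  benefit_system r p beta -> r <= \sum_(k < N) beta k.
Proof.
move=> [bP]; set G := \sum_(k < N) beta k => G0 bG.
rewrite leNgt; apply/negP => Gr.
suff : G <= 0 by rewrite leNgt G0.
apply: sumr_le0 => i _; have /andP[_ br] := bP i.
have rG : 1 - r / G <= 0 by rewrite subr_le0 ler_pdivlMr// mul1r ltW.
have := le_trans (bG i) (mulr_ge0_le0 (p0 i) rG).
by rewrite pmulr_lle0// invr_gt0 subr_gt0.
Qed.

Lemma benefit_systemP :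
  (exists beta : 'I_N -> R, benefit_system r p beta) <->
  (exists2 x : R, 0 <= x &
     \sum_(i < N) (p i * x / ((p i + 1) * x + 1)) >= x + 1).
Proof.
split=> [[beta bS]|[x x0 xS]].
- have rG := benefit_system_sum_ge bS.
  case: bS rG => bP; set G := \sum_(k < N) beta k => G0 bG rG.
  have x0 : 0 <= G / r - 1 by rewrite subr_ge0 ler_pdivlMr// mul1r.
  exists (G / r - 1) => //.
  have -> : G / r - 1 + 1 = \sum_(i < N) beta i / r by rewrite subrK mulr_suml.
  apply: ler_sum => i _.
  have /andP[_ br] := bP i; have := bG i.
  have den0 : 0 < (p i + 1) * (G / r - 1) + 1.
    by rewrite ltr_wpDl// mulr_ge0// addr_ge0.
  rewrite ler_pdivrMr ?subr_gt0// ler_pdivlMr// => h.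
  (* The factor [G / r] turns [1 - r / G] into [x = G / r - 1]. With [b = beta i / r] this leaves
     [b * (x + 1) <= p i * x * (1 - b)], which is linear in [b]. *)
  have := ler_wpM2r (ltW (divr_gt0 G0 r0)) h.
  have -> : p i * (1 - r / G) * (r - beta i) * (G / r) =
            p i * (G / r - 1) * (1 - beta i / r) * r.
    by field; rewrite !gt_eqF.
  have -> : beta i * (G / r) = beta i / r * (G / r) * r.
    by field; rewrite gt_eqF.
  by rewrite ler_pM2r//; lra.
- have x10 : 0 < x + 1 by rewrite ltr_wpDl.
  set S := \sum_(i < N) _ in xS.
  have S0 : 0 < S by exact: lt_le_trans xS.
  have den0 i : 0 < (p i + 1) * x + 1.
    by rewrite ltr_wpDl// mulr_ge0// addr_ge0.
  exists (fun i => r * (p i * x / ((p i + 1) * x + 1))).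
  rewrite /benefit_system -mulr_sumr -/S; split=> [i||i].
  + have q0 : 0 <= p i * x / ((p i + 1) * x + 1).
      by rewrite divr_ge0 ?(ltW (den0 i))// mulr_ge0.
    rewrite (mulr_ge0 (ltW r0) q0) /=.
    (* The denominator exceeds the numerator by [x + 1 > 0]. *)
    by rewrite gtr_pMr// ltr_pdivrMr//; lra.
  + exact: mulr_gt0.
  (* For [q = p i * x / ((p i + 1) * x + 1)] one has [1 - q = (x + 1) / ((p i + 1) * x + 1)], so
     [q / (1 - q)] depends on [i] only through the factor [p i]. *)
  + have -> : r * (p i * x / ((p i + 1) * x + 1)) /
              (r - r * (p i * x / ((p i + 1) * x + 1))) = p i * (x / (x + 1)).
      field; rewrite -mulrBr mulf_neq0 ?gt_eqF ?den0//.
      by rewrite [ltRHS](_ : _ = x + 1)//; ring.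
    apply: ler_wpM2l => //.
    (* Here Gamma is [r * S], so what remains is [S^-1 <= (x + 1)^-1], that is, [xS]. *)
    have -> : x / (x + 1) = 1 - (x + 1)^-1 by field; rewrite gt_eqF.
    have -> : r / (r * S) = S^-1 by field; rewrite !gt_eqF.
    by rewrite lerD2l lerN2 lef_pV2.
Qed.

End benefit_system.

Theorem mainTheorem2 (R : realType) (N n d : nat) (mu L sigma B D : R)
    (lambda : 'I_N -> R)
    (hN : (1 <= N)%N) (hn : (1 <= n)%N) (hd : (1 <= d)%N)
    (hmu : 0 < mu) (hmuL : mu <= L)
    (hsigma : 0 < sigma) (hB : 0 < B) (hD : 0 < D)
    (hlambda : forall i, 0 < lambda i) :
  let rho := rho N n mu L sigma D in
  let psi := psi n d mu L sigma B D lambda in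
  (exists beta : 'I_N -> R, benefit_system rho psi beta) <->
  (exists2 x : R, 0 <= x &
     \sum_(i < N) (psi i * x / ((psi i + 1) * x + 1)) >= x + 1).
Proof.
have L0 : 0 < L by exact: lt_le_trans hmuL.
by apply: benefit_systemP => [|i]; [exact: rho_gt0|apply: psi_ge0; exact: ltW].
Qed.
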